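(* Let $A \in \mathbb{R}^{n\times n}$ and suppose that at least one of the following conditions holds: (i) the inequality $|Ax| \leq |x|$ has a non-trivial solution $x \in \mathbb{R}^n$, $x \neq 0$; (ii) $\sigma_{\max}(A) \leq 1$; (iii) $I_n - A^{T}A$ is positive semi-definite; (iv) $0$ or $1$ is an eigenvalue of $A$. Then it is not the case that the absolute value equation $Ax - |x| = b$ has exactly one solution $x \in \mathbb{R}^n$ for every $b \in \mathbb{R}^n$; that is, there exists $b \in \mathbb{R}^n$ for which the equation $Ax - |x| = b$ does not have exactly one solution.
   Context: For a vector $x \in \mathbb{R}^n$, $|x|$ denotes the vector of component-wise absolute values of $x$, and vector inequalities are entrywise. $I_n$ is the $n\times n$ identity matrix and $\sigma_{\max}$ denotes the maximum singular value of a matrix. *)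

(* Defs.v *)
From mathcomp Require Import all_boot all_order all_algebra.
From mathcomp Require Import all_classical all_reals.

Set Implicit Arguments.
Unset Strict Implicit.
Unset Printing Implicit Defensive.

Import Order.TTheory GRing.Theory Num.Theory.

Local Open Scope classical_set_scope.
Local Open Scope ring_scope.

(* Not written with the bare norm notation: on matrices, once the analysis
   library is loaded, that denotes the (scalar) sup norm. *)
Definition absv (R : realType) (n : nat) (x : 'cV[R]_n) : 'cV[R]_n :=
  map_mx (fun t : R => `|t|) x.

Definition lev (R : realType) (n : nat) (x y : 'cV[R]_n) : Prop :=
  forall i : 'I_n, x i 0 <= y i 0.

Definition singular_values (R : realType) (n : nat) (A : 'M[R]_n) : set R :=
  [set s | exists2 l : R, eigenvalue (A^T *m A) l & s = Num.sqrt l].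

(* For n > 0 the set of singular values is finite and nonempty, so the supremum
   is a maximum; for n = 0 it is empty and sigma_max A = 0 by convention. *)
Definition sigma_max (R : realType) (n : nat) (A : 'M[R]_n) : R :=
  sup (singular_values A).

Definition possemidef (R : realType) (n : nat) (M : 'M[R]_n) : Prop :=
  M^T = M /\ forall x : 'cV[R]_n, 0 <= (x^T *m M *m x) 0 0.

(* Main.v *)
(* If x <> 0 and |y| <= |x| with y = A x, then x = u - v and y = |u| - |v| for
   suitable u <> v, so A u - |u| = A v - |v|. It remains to produce such an x in
   the other cases. Eigenvectors do for (iv). In cases (ii) and (iii), A is a
   Euclidean contraction, so det (I - D A) >= 0 for every diagonal D with
   entries +1 or -1. Taking D = I and D = diag(-1, 1, ..., 1), the numbers
   det (I - A) and det (D - A) = - det (I - D A) have opposite signs, so some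
   diagonal matrix E on the segment from I to D has a nonzero x with
   A x = E x, and |E x| <= |x|. *)
Require Import Defs.
From mathcomp Require Import all_boot all_order all_algebra.
From mathcomp Require Import all_classical all_reals.
From mathcomp Require Import complex polyrcf.
From mathcomp Require Import ring lra.
Import Order.TTheory GRing.Theory Num.Theory.
Local Open Scope ring_scope.

Set Implicit Arguments.
Unset Strict Implicit.

Lemma det0_colP (F : fieldType) (n : nat) (M : 'M[F]_n) :
  \det M = 0 -> exists2 x : 'cV[F]_n, x != 0 & M *m x = 0.
Proof.
move=> /eqP; rewrite -det_tr => /det0P [v v0 vM].
exists v^T; first by rewrite trmx_eq0.
by rewrite -[M]trmxK -trmx_mul vM trmx0.
Qed.

(** Along the segment from [M] to [N] the determinant is a polynomial in [t], so the intermediate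
    value theorem applies. *)
Lemma det_segment_root (R : rcfType) (n : nat) (M N : 'M[R]_n) :
  \det M * \det N <= 0 ->
  exists2 t : R, 0 <= t <= 1 & \det (M + t *: (N - M)) = 0.
Proof.
move=> MN.
pose p := \det (map_mx polyC M + 'X *: map_mx polyC (N - M)).
have pE t : p.[t] = \det (M + t *: (N - M)).
  rewrite -[LHS]/(horner_eval t p) -det_map_mx; congr (\det _).
  by apply/matrixP => i j; rewrite !mxE /= /horner_eval !hornerE.
have [||t t01 /rootP pt] := @polyrcf.poly_ivt R p 0 1; first exact: ler01.
  by rewrite !pE scale0r scale1r addr0 addrC subrK.
by exists t; [rewrite in_itv in t01 | rewrite -pE].
Qed.

Lemma sqnormE (R : comNzRingType) (n : nat) (x : 'cV[R]_n) :
  (x^T *m x) 0 0 = \sum_i x i 0 ^+ 2.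
Proof. by rewrite mxE; apply: eq_bigr => i _; rewrite mxE expr2. Qed.

Lemma sqnorm_gt0 (R : realDomainType) (n : nat) (x : 'cV[R]_n) :
  x != 0 -> 0 < (x^T *m x) 0 0.
Proof.
move=> x0; rewrite sqnormE lt0r sumr_ge0 ?andbT => [|i _]; last exact: sqr_ge0.
apply: contraNneq x0 => /psumr_eq0P x_eq0; apply/eqP/colP => i.
by apply/eqP; rewrite mxE -sqrf_eq0 x_eq0 // => j _; exact: sqr_ge0.
Qed.

(** Otherwise the determinant vanishes between [1%:M] and [1%:M - B], at some [1%:M - t *: B] with
    [t < 1]. A kernel vector satisfies [x = t *: (B *m x)], so its squared norm is at most [t ^+ 2]
    times itself, which is absurd. *)
Lemma det_1sub_contraction_ge0 (R : rcfType) (n : nat) (B : 'M[R]_n) :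
    (forall x : 'cV_n, ((B *m x)^T *m (B *m x)) 0 0 <= (x^T *m x) 0 0) ->
  0 <= \det (1%:M - B).
Proof.
move=> Bcontr; rewrite leNgt; apply/negP => det_lt0.
have [|t /andP[t0 t1] dett] := @det_segment_root R n 1%:M (1%:M - B).
  by rewrite det1 mul1r ltW.
have tE : 1%:M + t *: (1%:M - B - 1%:M) = 1%:M - t *: B.
  by rewrite addrAC subrr add0r scalerN.
rewrite tE in dett.
have {}t1 : t < 1.
  rewrite lt_neqAle t1 andbT; apply: contraTneq det_lt0 => t_eq1.
  by move: dett; rewrite t_eq1 scale1r => ->; rewrite ltxx.
have [x x0] := det0_colP dett.
rewrite mulmxBl mul1mx -scalemxAl => /subr0_eq xE.
have := sqnorm_gt0 x0; rewrite ltNge => /negP; apply.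
have xx : (x^T *m x) 0 0 = t ^+ 2 * ((B *m x)^T *m (B *m x)) 0 0.
  by rewrite {1 2}xE -scalemxAr linearZ /= -scalemxAl !mxE expr2 mulrA.
have tt : t ^+ 2 < 1 by rewrite expr_lt1.
have := Bcontr x; move: xx tt (sqr_ge0 t).
by nra.
Qed.

Lemma AVE_not_unique (R : realType) (n : nat) (A : 'M[R]_n) (x : 'cV[R]_n) :
  x <> 0 -> lev (absv (A *m x)) (absv x) ->
  exists b : 'cV[R]_n, ~ (exists! x : 'cV[R]_n, A *m x - absv x = b).
Proof.
move=> x0 Ax_le; have [y Ay] : exists y, A *m x = y by exists (A *m x).
rewrite Ay in Ax_le.
(* The pair [u], [v] solves [u - v = x] and [u + v = s y] entrywise. As [|y| <= |x|], the entries of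
   [s u] are nonnegative and those of [s v] nonpositive, so [|u| - |v| = s (u + v) = y]. *)
pose s i : R := if 0 <= x i 0 then 1 else -1.
pose u : 'cV[R]_n := \col_i ((x i 0 + s i * y i 0) / 2).
pose v : 'cV[R]_n := \col_i ((s i * y i 0 - x i 0) / 2).
have uvx : u - v = x by apply/colP => i; rewrite !mxE; field.
have uvy : absv u - absv v = y.
  apply/colP => i; move: (Ax_le i); rewrite /absv !mxE /s.
  set a := y i 0; set c := x i 0 => ac.
  move: ac; rewrite ler_norml => /andP[]; case: (lerP 0 c) => c0.
    rewrite (ger0_norm c0) => ca ac.
    have cDa : 0 <= (c + 1 * a) / 2 by lra.
    have aBc : (1 * a - c) / 2 <= 0 by lra.
    by rewrite (ger0_norm cDa) (ler0_norm aBc); lra.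
  rewrite (ltr0_norm c0) => ca ac.
  have cBa : (c + -1 * a) / 2 <= 0 by lra.
  have acN : 0 <= (-1 * a - c) / 2 by lra.
  by rewrite (ler0_norm cBa) (ger0_norm acN); lra.
exists (A *m v - absv v) => -[z [_ zP]].
have uv : u = v.
  rewrite -(zP v) //; apply/esym/zP.
  apply/eqP; rewrite -subr_eq0 opprD addrACA -mulmxBr uvx Ay -opprD uvy.
  by rewrite subrr.
by apply: x0; rewrite -uvx uv subrr.
Qed.

Lemma contraction_lev (R : realType) (n : nat) (A : 'M[R]_n) :
  (0 < n)%N ->
  (forall x : 'cV_n, ((A *m x)^T *m (A *m x)) 0 0 <= (x^T *m x) 0 0) ->
  exists2 x : 'cV[R]_n, x != 0 & lev (absv (A *m x)) (absv x).
Proof.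
move=> n0 Acontr; pose i0 := Ordinal n0.
(* A reflection in one coordinate: it preserves the Euclidean norm, so [D *m A] is again a
   contraction, while its determinant is -1. *)
pose D : 'M[R]_n := diag_mx (\row_i (if i == i0 then -1 else 1)).
have DD : D *m D = 1%:M.
  apply/matrixP => i j; rewrite mul_diag_mx !mxE.
  case: (i == j); case: (i == _);
    by rewrite ?mulr0n ?mulr1n ?mulr0 ?mulr1 ?mulrN1 ?opprK.
have DT : D^T = D by rewrite tr_diag_mx.
have detD : \det D = -1.
  rewrite det_diag (bigD1 i0) //= big1 => [|i /negPf ii0].
    by rewrite mxE eqxx mulr1.
  by rewrite mxE ii0.
have det1A : 0 <= \det (1%:M - A) by apply: det_1sub_contraction_ge0.
have detDA : 0 <= \det (1%:M - D *m A).
  apply: det_1sub_contraction_ge0 => x.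
  by rewrite -!mulmxA trmx_mul DT mulmxA -[_ *m D *m D]mulmxA DD mulmx1.
have DAE : D - A = D *m (1%:M - D *m A).
  by rewrite mulmxBr mulmx1 mulmxA DD mul1mx.
have [|t /andP[t0 t1] dett] := @det_segment_root R n (1%:M - A) (D - A).
  by rewrite DAE det_mulmx detD mulN1r mulrN oppr_le0 mulr_ge0.
have [x x0 xE] := det0_colP dett.
(* The singular matrix is [E - A] with [E] diagonal, its entries being 1 except for [1 - 2 * t], in
   [-1, 1], at [i0]. *)
move: xE; have -> : 1%:M - A + t *: (D - A - (1%:M - A)) =
                    (1%:M + t *: (D - 1%:M)) - A.
  by rewrite opprB addrA subrK addrAC.
rewrite mulmxBl => /subr0_eq xE.
exists x => // i.
rewrite /absv -xE mulmxDl mul1mx -scalemxAl mulmxBl mul1mx mul_diag_mx !mxE.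
case: (i == _); last by rewrite mul1r subrr mulr0 addr0.
have -> : x i 0 + t * (-1 * x i 0 - x i 0) = (1 - 2 * t) * x i 0 by ring.
by rewrite normrM ler_piMl // ler_norml; lra.
Qed.

(** Needed for [sigma_max] to dominate each singular value, since [sup] of an unbounded set is a
    default value. The Cauchy bound on the roots of the characteristic polynomial provides it. *)
Lemma has_ubound_singular_values (R : realType) (n : nat) (A : 'M[R]_n) :
  has_ubound (singular_values A).
Proof.
set p := char_poly (A^T *m A).
exists (Num.sqrt (cauchy_bound p)) => _ [l + ->].
rewrite eigenvalue_root_char => pl; apply: ler_wsqrtr.
have p0 : p != 0 by apply/monic_neq0/char_poly_monic.
exact: ltW (le_lt_trans (ler_norm l) (cauchy_boundP p0 (rootP pl))).
Qed.

Section SymmetricMatrices.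
Local Open Scope sesquilinear_scope.

(** Over the complex numbers [S] is Hermitian, hence unitarily diagonalisable. In the coordinates
    [w = P x] the two forms are the sums of [d_i |w_i|^2] and of [|w_i|^2]. *)
Lemma symmetric_quadform_le (R : rcfType) (n : nat) (S : 'M[R]_n) :
  S^T = S -> (forall l, eigenvalue S l -> l <= 1) ->
  forall x : 'cV_n, (x^T *m S *m x) 0 0 <= (x^T *m x) 0 0.
Proof.
move=> Ssym S_le1 x.
pose f := real_complex R.
have fJ m p (M : 'M[R]_(m, p)) : (map_mx f M)^t* = map_mx f M^T.
  apply/matrixP => i j; rewrite !mxE; apply/CrealP/complex_realP.
  by exists (M j i).
pose H := map_mx f S.
have Hherm : H \is hermsymmx.
  by apply/is_hermitianmxP; rewrite expr0 scale1r fJ Ssym.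
set P := spectralmx H; set d := spectral_diag H.
have HE : H = invmx P *m diag_mx d *m P.
  exact/orthomx_spectralP/hermitian_normalmx.
have Pu : P \is unitarymx := spectral_unitarymx H.
have PV := invmx_unitary Pu.
(* Row [i] of [P] is a left eigenvector of [H] for [d 0 i]; this value is real, so it is already an
   eigenvalue of [S]. *)
have d_le1 i : d 0 i <= 1.
  have /mxOverP/(_ 0 i) dr := hermitian_spectral_diag_real Hherm.
  have : eigenvalue H (d 0 i).
    apply/eigenvalueP; exists (row i P).
      rewrite -row_mul HE !mulmxA mulmxV ?spectral_unit // mul1mx.
      by apply/rowP => j; rewrite mul_diag_mx !mxE.
    apply/eqP => Pi0; have /rowP/(_ i) := congr1 (mulmx^~ (invmx P)) Pi0.
    rewrite -row_mul mulmxV ?spectral_unit // mul0mx !mxE eqxx => /eqP.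
    by rewrite oner_eq0.
  by rewrite -(RRe_real dr) (eigenvalue_map f) => /S_le1; rewrite -lecR.
pose w := P *m map_mx f x.
have wE : w^t* = map_mx f x^T *m invmx P.
  by rewrite trmx_mul map_mxM PV fJ.
have xSx : f ((x^T *m S *m x) 0 0) = \sum_i d 0 i * `|w i 0| ^+ 2.
  transitivity ((w^t* *m diag_mx d *m w) 0 0).
    have -> : f ((x^T *m S *m x) 0 0) = (map_mx f (x^T *m S *m x)) 0 0.
      by rewrite [RHS]mxE.
    by rewrite !map_mxM -/H {1}HE wE /w !mulmxA.
  rewrite -mulmxA mul_diag_mx mxE; apply: eq_bigr => i _.
  by rewrite !mxE normCKC mulrCA.
have xx : f ((x^T *m x) 0 0) = \sum_i `|w i 0| ^+ 2.
  transitivity ((w^t* *m w) 0 0).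
    have -> : f ((x^T *m x) 0 0) = (map_mx f (x^T *m x)) 0 0.
      by rewrite [RHS]mxE.
    by rewrite map_mxM wE /w mulmxA mulmxKV ?spectral_unit.
  by rewrite mxE; apply: eq_bigr => i _; rewrite !mxE normCKC.
rewrite -lecR -/f xSx xx; apply: ler_sum => i _.
by rewrite ler_piMl ?exprn_ge0.
Qed.

End SymmetricMatrices.

Theorem proposition5 (R : realType) (n : nat) (hn : (0 < n)%N) (A : 'M[R]_n)
  (hA : (exists x : 'cV[R]_n, x <> 0 /\ lev (absv (A *m x)) (absv x))
        \/ sigma_max A <= 1
        \/ possemidef (1%:M - A^T *m A)
        \/ (eigenvalue A 0 \/ eigenvalue A 1)) :
  exists b : 'cV[R]_n, ~ (exists! x : 'cV[R]_n, A *m x - absv x = b).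
Proof.
suff [x x0 Ax] : exists2 x : 'cV[R]_n, x != 0 & lev (absv (A *m x)) (absv x).
  by apply: AVE_not_unique Ax; apply/eqP.
have eig_case a : eigenvalue A a -> `|a| <= 1 ->
    exists2 x : 'cV[R]_n, x != 0 & lev (absv (A *m x)) (absv x).
  move=> /eigenvalueP [v vA v0] a1.
  (* [eigenvalue] supplies a row eigenvector; a column one comes from the singularity of
     [A - a%:M]. *)
  have [|x x0] := @det0_colP _ _ (A - a%:M).
    by apply/eqP/det0P; exists v; rewrite // mulmxBr vA mul_mx_scalar subrr.
  rewrite mulmxBl mul_scalar_mx => /subr0_eq Ax.
  by exists x => // i; rewrite Ax !mxE normrM ler_piMl.
have contr_case :
    (forall x : 'cV_n, (x^T *m (A^T *m A) *m x) 0 0 <= (x^T *m x) 0 0) ->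
    exists2 x : 'cV[R]_n, x != 0 & lev (absv (A *m x)) (absv x).
  move=> Acontr; apply: contraction_lev hn _ => x.
  by rewrite trmx_mul mulmxA -[_ *m _ *m A]mulmxA Acontr.
case: hA => [[x [/eqP x0 Ax]]|[sA|[[_ psd]|[e0|e1]]]].
- by exists x.
- apply: contr_case; apply: symmetric_quadform_le => [|l Al].
    by rewrite trmx_mul trmxK.
  have sl1 : Num.sqrt l <= 1.
    apply: le_trans sA; apply: (ub_le_sup (has_ubound_singular_values A)).
    by exists l.
  rewrite leNgt; apply/negP => l1; move: sl1; rewrite leNgt => /negP; apply.
  by rewrite -[ltLHS]sqrtr1 ltr_sqrt // (lt_trans ltr01).
- apply: contr_case => x; rewrite -subr_ge0.
  by have := psd x; rewrite mulmxBr mulmxBl mulmx1 mxE [X in _ + X]mxE.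
- by apply: eig_case e0 _; rewrite normr0.
- by apply: eig_case e1 _; rewrite normr1.
Qed.
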